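(* Let $\mathcal{A}=\mathbb{C}[x,y]$, let $n$ be a positive integer, let $\alpha_1,\dots,\alpha_n\in\mathbb{C}$ with $\alpha_1\alpha_n\neq 0$, put $h_t=\sum_{i=1}^n\alpha_i t^{i-1}\in\mathbb{C}[t]$ and assume $\gcd(h_t,h_t')=1$ in $\mathbb{C}[t]$. Let $h_{xy}=h_t(xy)=\sum_{i=1}^n\alpha_i(xy)^{i-1}$, $h=xy\,h_{xy}$, $\mathcal I=h\mathcal A$. Let $E_2=x\partial_x+y\partial_y$, $R=y\partial_y-x\partial_x$, and consider $$\mathcal B=\big(\delta^1=h_{xy}E_2,\ \delta^2=R\big),\qquad \mathcal B^*=\Big(\omega_1=\frac{y}{2h}dx+\frac{x}{2h}dy,\ \omega_2=\frac{dy}{2y}-\frac{dx}{2x}\Big).$$ Then $\mathcal B$ is a Saito basis of $Der_{\mathcal A}(\log\mathcal I)$, and $\mathcal B^*$ is a dual Saito basis of $\Omega^1_{\mathcal A}(\log\mathcal I)$.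
   Context: $Der_{\mathcal A}(\log\mathcal I)$ is the $\mathcal A$-module of derivations $\delta$ of $\mathcal A$ with $\delta(h)\in h\mathcal A$. $\Omega^1_{\mathcal A}(\log\mathcal I)$ is its dual, the module of logarithmic 1-forms, i.e. the rational 1-forms $\omega$ with $\omega(\delta)\in\mathcal A$ for all $\delta\in Der_{\mathcal A}(\log\mathcal I)$. A Saito basis of $Der_{\mathcal A}(\log\mathcal I)$ is a system of vector fields $(\delta^1,\delta^2)$ with $\delta^i(h)\in(h)$ and $\det(\delta^1,\delta^2)=u\,h$ for some $u\in\mathcal A$, where the determinant is that of the coefficient matrix with respect to $\partial_x,\partial_y$ (a free Saito basis if $u$ is a unit). A Saito basis of $\Omega^1_{\mathcal A}(\log\mathcal I)$ is a system of logarithmic 1-forms $(\omega_1,\omega_2)$ with $\omega_1\wedge\omega_2=\frac{\text{unit}}{h}dx\wedge dy$. It is dual to $(\delta^1,\delta^2)$ if $\delta^i\lrcorner\omega_j=\omega_j(\delta^i)$ equals the Kronecker symbol $\delta_{ij}$ for all $i,j$. *)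

(* Defs.v *)
From HB Require Import structures.
From mathcomp Require Export all_boot all_order all_algebra.
From mathcomp Require Export reals.
From mathcomp Require Export complex mpoly.

Set Implicit Arguments.
Unset Strict Implicit.
Unset Printing Implicit Defensive.

Import GRing.Theory.
Local Open Scope ring_scope.

(* The polynomial ring C[x, y] is {mpoly C[2]}, with x = 'X_0 and y = 'X_1;
   rational functions are elements of its field of fractions. *)
Notation ratfun C := {fraction {mpoly C[2]}}.
Notation "p %:F" := (@FracField.tofrac _ p) : ring_scope.

Section LogarithmicModules.

Variable C : fieldType.
Local Notation A := {mpoly C[2]}.
Implicit Types (h f g : A) (d : A -> A).

Definition is_derivation d : Prop :=
  linear d /\ forall f g, d (f * g) = d f * g + f * d g.

Definition log_der h d : Prop :=
  is_derivation d /\ exists g, d h = h * g.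

(* a d/dx + b d/dy *)
Definition vect_field (a b : A) : A -> A :=
  fun f => a * f^`M(0) + b * f^`M(1).

(* Every derivation is d(x) d/dx + d(y) d/dy. *)
Lemma is_derivationE d : is_derivation d -> d =1 vect_field (d 'X_0) (d 'X_1).
Proof.
move=> [dlin dM] f.
have dD p q : d (p + q) = d p + d q by have := dlin 1 p q; rewrite !scale1r.
have d0 : d 0 = 0 by apply: (addrI (d 0)); rewrite -dD !addr0.
have dZ c p : d (c *: p) = c *: d p by have := dlin c p 0; rewrite d0 !addr0.
have d1 : d 1 = 0.
  by apply: (addrI (d 1)); have := dM 1 1; rewrite !mulr1 mul1r addr0.
set v := vect_field _ _.
have vD p q : v (p + q) = v p + v q.
  by rewrite /v /vect_field !mderivD !mulrDr addrACA.
have vZ c p : v (c *: p) = c *: v p.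
  by rewrite /v /vect_field !mderivZ -!scalerAr scalerDr.
have vM p q : v (p * q) = v p * q + p * v q.
  rewrite /v /vect_field !mderivM !mulrDr !mulrDl.
  rewrite addrACA -!mulrA; congr (_ + (_ + _)); exact: mulrCA.
have v1 : v 1 = 0 by rewrite /v /vect_field -mpolyC1 !mderivC !mulr0 addr0.
have dvM p q : d p = v p -> d q = v q -> d (p * q) = v (p * q).
  by move=> ep eq; rewrite dM vM ep eq.
have dvX (i : 'I_2) : d 'X_i = v 'X_i.
  rewrite /v /vect_field !mderivX !mnm1E.
  have [->|->] : i = 0 \/ i = 1.
  - by case: i => [[|[|//]] lti]; [left | right]; apply: val_inj.
  - rewrite eqxx [0 == 1]/= !scale0r mulr0 addr0 scale1r.
    by rewrite -[X in (X - _)%MM]add0m addmK mpolyX0 mulr1.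
  - rewrite eqxx [1 == 0]/= !scale0r mulr0 add0r scale1r.
    by rewrite -[X in (X - _)%MM]add0m addmK mpolyX0 mulr1.
elim/mpolyind: f => [|c m p _ _ IH].
  by rewrite d0 /v /vect_field !mderiv0 !mulr0 addr0.
rewrite dD vD dZ vZ IH; congr (_ *: _ + _).
rewrite mpolyXE_id; elim/big_ind: _ => [|p1 q1|i _]; rewrite ?d1 ?v1 //.
  exact: dvM.
elim: (m i) => [|k IHk]; first by rewrite expr0 d1 v1.
by rewrite exprS; exact: dvM.
Qed.

(* By is_derivationE, the coefficients of d with respect to d/dx, d/dy are
   d 'X_0 and d 'X_1. *)
Definition coef_mx (D : 2.-tuple (A -> A)) : 'M[A]_2 :=
  \matrix_(i, j) (tnth D i) 'X_j.

(* The factor u is arbitrary; the basis is free when u is a unit. *)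
Definition saito_basis_der h (D : 2.-tuple (A -> A)) : Prop :=
  (forall i, log_der h (tnth D i)) /\ exists u : A, \det (coef_mx D) = u * h.

(* The rational 1-form a dx + b dy is the row vector of its coefficients. *)
Definition ratform := 'rV[ratfun C]_2.
Definition dx : ratform := delta_mx 0 0.
Definition dy : ratform := delta_mx 0 1.

Definition contract d (w : ratform) : ratfun C :=
  \sum_(j < 2) w 0 j * (d 'X_j)%:F.

Definition log_form h (w : ratform) : Prop :=
  forall d, log_der h d -> exists g : A, contract d w = g%:F.

(* The coefficient of w1 /\ w2 with respect to dx /\ dy. *)
Definition wedge (w1 w2 : ratform) : ratfun C :=
  w1 0 0 * w2 0 1 - w1 0 1 * w2 0 0.

Definition saito_basis_form h (W : 2.-tuple ratform) : Prop :=
  (forall j, log_form h (tnth W j)) /\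
  exists2 u : A, u \is a GRing.unit & wedge (tnth W 0) (tnth W 1) = u%:F / h%:F.

Definition dual_bases (D : 2.-tuple (A -> A)) (W : 2.-tuple ratform) : Prop :=
  forall i j, contract (tnth D i) (tnth W j) = (i == j)%:R.

End LogarithmicModules.

Arguments dx {C}.
Arguments dy {C}.

(* Main.v *)
Require Import Defs.
From mathcomp Require Import ring.

Set Implicit Arguments.
Unset Strict Implicit.
Unset Printing Implicit Defensive.

Import GRing.Theory.
Local Open Scope ring_scope.

(** Put H(t) = t h_t. Since h_t is coprime to h_t' and to t, the polynomials H
    and H' are coprime. A derivation d satisfies d(h) = d(H(xy)) = H'(xy) d(xy),
    so if h = H(xy) divides d(h), Bezout gives h | d(xy) = y d(x) + x d(y). This
    says that omega_1(d) is a polynomial; it also forces x | d(x) and y | d(y),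
    so that omega_2(d) is a polynomial. *)

Lemma det_mx22 (S : comNzRingType) (M : 'M[S]_2) :
  \det M = M 0 0 * M 1 1 - M 0 1 * M 1 0.
Proof.
have lift0 : lift ord0 ord0 = 1 :> 'I_2 by apply: val_inj.
have lift1 : lift 1 ord0 = 0 :> 'I_2 by apply: val_inj.
rewrite (expand_det_row _ 0) big_ord_recl big_ord1 lift0 /cofactor !det_mx11 !mxE.
rewrite lift0 lift1 /= expr0 expr1; ring.
Qed.

(** * Coprimality in one variable *)

Section PolynomialFacts.

Variable K : fieldType.
Implicit Types p : {poly K}.

(** The derivative is [p + 'X * p^]()[. Modulo]'X[it is]p[, which is coprime to]'X[because]p.[0] !=
    0[; modulo]p[it is]'X * p^[()], a product of two factors coprime to [p]. *)
Lemma coprimep_mulX_deriv p :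
  p.[0] != 0 -> coprimep p p^`() -> coprimep ('X * p) ('X * p)^`().
Proof.
move=> p0 cp.
have cXp : coprimep 'X p.
  by rewrite -['X]subr0 -polyC0 coprimep_sym coprimep_XsubC /root.
rewrite derivM derivX mul1r coprimepMl; apply/andP; split.
  by rewrite addrC mulrC coprimep_addl_mul.
have -> : p + 'X * p^`() = 1 * p + 'X * p^`() by rewrite mul1r.
by rewrite coprimep_addl_mul coprimepMr cp coprimep_sym cXp.
Qed.

End PolynomialFacts.

(** * Divisibility by a variable *)

Section MultivariateDivisibility.

Variables (n : nat) (K : idomainType).
Implicit Types p q : {mpoly K[n]}.

Lemma mpolyX_neq0 (m : 'X_{1..n}) : 'X_[m] != 0 :> {mpoly K[n]}.
Proof.
by apply/eqP => /(congr1 (mcoeff m)) /eqP; rewrite mcoeffX eqxx mcoeff0 oner_eq0.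
Qed.

(** Setting ['X_i] to 0 kills the right-hand side and fixes ['X_j], so in a domain it must kill
    [p]. *)
Lemma mpolyX_dvd_mulX (i j : 'I_n) p q :
  i != j -> 'X_j * p = 'X_i * q -> exists r, p = 'X_i * r.
Proof.
move=> neq_ij eq_pq.
pose v k : {mpoly K[n]} := if k == i then 0 else 'X_k.
have [e [eX eZ]] : exists e : {rmorphism {mpoly K[n]} -> {mpoly K[n]}},
    (forall k, e 'X_k = v k) /\ forall c f, e (c *: f) = c *: e f.
  exists (mmap (@mpolyC n K) v).
  by split=> [k|c f] /=; rewrite ?mmapX ?mmap1U // mmapZ mul_mpolyC.
(* [e] substitutes 0 for 'X_i, hence is the identity modulo 'X_i. *)
have eE f : exists r, f = 'X_i * r + e f.
  elim/mpolyind: f => [|c m f _ _ [r IH]]; first by exists 0; rewrite rmorph0; ring.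
  suff [s em] : exists s, 'X_[m] = 'X_i * s + e 'X_[m].
    exists (c *: s + r); rewrite rmorphD /= eZ {1}em {1}IH scalerDr scalerAr; ring.
  have eM f1 f2 : (exists s, f1 = 'X_i * s + e f1) ->
      (exists s, f2 = 'X_i * s + e f2) -> exists s, f1 * f2 = 'X_i * s + e (f1 * f2).
    move=> [s1 e1] [s2 e2]; exists (s1 * f2 + e f1 * s2).
    by rewrite rmorphM {1}e1 mulrDl {2}e2; ring.
  have e1 : exists s, 1 = 'X_i * s + e 1 by exists 0; rewrite rmorph1; ring.
  rewrite mpolyXE_id; elim/big_ind: _ => [||k _]; [exact: e1 | exact: eM |].
  elim: (m k) => [|l IHl]; first by rewrite expr0.
  rewrite exprS; apply: eM; last exact: IHl.
  rewrite eX /v.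
  by case: eqP => [->|_]; [exists 1 | exists 0]; ring.
have : e ('X_j * p) = 0 by rewrite eq_pq rmorphM eX /v eqxx mul0r.
rewrite rmorphM eX /v eq_sym (negPf neq_ij) => /eqP.
rewrite mulf_eq0 => /orP[|/eqP ep0].
  by rewrite (negPf (mpolyX_neq0 _)).
by have [r ->] := eE p; exists r; rewrite ep0 addr0.
Qed.

End MultivariateDivisibility.

(** * Vector fields and the chain rule *)

Section Derivations.

Variable C : fieldType.
Local Notation A := {mpoly C[2]}.
Implicit Types (h f g a b : A) (d : A -> A).

Lemma vect_field_derivation a b : is_derivation (vect_field a b).
Proof.
split=> [c f g|f g]; rewrite /vect_field.
  rewrite !mderivD !mderivZ !mulrDr -!scalerAr scalerDr; ring.
rewrite !mderivM; ring.
Qed.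

Lemma mul_derivation g d : is_derivation d -> is_derivation (fun f => g * d f).
Proof.
move=> [dlin dM]; split=> [c f k|f k]; first by rewrite dlin mulrDr scalerAr.
by rewrite dM; ring.
Qed.

Lemma vect_fieldX0 a b : vect_field a b 'X_0 = a.
Proof.
rewrite /vect_field !mderivX !mnm1E /= scale1r scale0r mulr0 addr0.
by rewrite -[X in (X - _)%MM]add0m addmK mpolyX0 mulr1.
Qed.

Lemma vect_fieldX1 a b : vect_field a b 'X_1 = b.
Proof.
rewrite /vect_field !mderivX !mnm1E /= scale1r scale0r mulr0 add0r.
by rewrite -[X in (X - _)%MM]add0m addmK mpolyX0 mulr1.
Qed.

(** Chain rule, by Horner induction on [p]; constants are killed because the Leibniz rule at [1 * 1]
    forces [d 1 = 0]. *)
Lemma derivation_horner_alg d z (p : {poly C}) : is_derivation d ->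
  d (horner_alg z p) = horner_alg z p^`() * d z.
Proof.
move=> [dlin dM].
have dD f g : d (f + g) = d f + d g by have := dlin 1 f g; rewrite !scale1r.
have d0 : d 0 = 0 by apply: (addrI (d 0)); rewrite -dD !addr0.
have dZ c f : d (c *: f) = c *: d f by have := dlin c f 0; rewrite d0 !addr0.
have d1 : d 1 = 0.
  by apply: (addrI (d 1)); have := dM 1 1; rewrite !mulr1 mul1r addr0.
elim/poly_ind: p => [|p c IH]; first by rewrite deriv0 !rmorph0 mul0r d0.
rewrite derivD derivM derivX derivC mulr1 addr0 !rmorphD !rmorphM /=.
rewrite horner_algX horner_algC dD dZ d1 dM IH; ring.
Qed.

End Derivations.

(* Here (y / 2h, x / 2h) and (- 1 / 2x, 1 / 2y) are the coefficients of the forms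
   omega_1 and omega_2, and (a, b) those of a vector field. *)
Section DualFormIdentities.

Variables (F : fieldType) (x y h : F).
Hypotheses (two0 : 2 != 0 :> F) (x0 : x != 0) (y0 : y != 0) (h0 : h != 0).

(** The form omega_1 is d(xy) / 2h, and [a * y + x * b] is the derivative of xy along the field. *)
Lemma pairing_omega1 a b c :
  a * y + x * b = h * c -> y / (2 * h) * a + x / (2 * h) * b = 2^-1 * c.
Proof.
move=> eq_c.
have -> : y / (2 * h) * a + x / (2 * h) * b = (a * y + x * b) / (2 * h) by ring.
by rewrite eq_c; field; rewrite h0 two0.
Qed.

(** The form omega_2 is half the logarithmic differential of y / x; [r] and [s] are the logarithmic
    derivatives of x and y along the field. *)
Lemma pairing_omega2 r s :
  - (2 * x)^-1 * (x * r) + (2 * y)^-1 * (y * s) = 2^-1 * (s - r).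
Proof. by field; rewrite x0 y0 two0. Qed.

Lemma wedge_omega12 :
  y / (2 * h) * (2 * y)^-1 - x / (2 * h) * - (2 * x)^-1 = 2^-1 / h.
Proof. by field; rewrite x0 y0 h0 two0. Qed.

End DualFormIdentities.

(** * Divisibility forced on logarithmic derivations *)

Section LogarithmicDerivations.

Variables (C : fieldType) (p : {poly C}).
Hypotheses (p0 : p.[0] != 0) (cp : coprimep p p^`()).
Local Notation A := {mpoly C[2]}.
Let z : A := 'X_0 * 'X_1.
Let h : A := z * horner_alg z p.

Lemma log_der_mulXX_dvd (d : A -> A) : log_der h d -> exists k, d z = h * k.
Proof.
move=> [der_d [g dh]].
have hE : h = horner_alg z ('X * p) by rewrite rmorphM /= horner_algX.
have /Bezout_eq1_coprimepP[[u v] /= uv] := coprimep_mulX_deriv p0 cp.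
have /(congr1 (horner_alg z)) := uv.
rewrite rmorphD (rmorphM _ u) (rmorphM _ v) rmorph1 /= -hE => bez.
have dhE : h * g = horner_alg z ('X * p)^`() * d z.
  by rewrite -dh hE derivation_horner_alg.
(* Multiply the Bezout identity, evaluated at [z], by [d z], then replace H'(z) [d z] by [h * g]. *)
exists (horner_alg z u * d z + horner_alg z v * g).
rewrite mulrDr [h * (_ * g)]mulrCA dhE -[LHS]mul1r -bez; ring.
Qed.

(** In y d(x) + x d(y) = [h * k] the right-hand side is a multiple of xy, so x divides y d(x) and y
    divides x d(y). *)
Lemma log_der_X_dvd (d : A -> A) : log_der h d ->
  (exists r, d 'X_0 = 'X_0 * r) /\ (exists s, d 'X_1 = 'X_1 * s).
Proof.
move=> log_d; have [k] := log_der_mulXX_dvd log_d.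
have [[_ dM] _] := log_d; rewrite /h {1}/z dM => eq_k.
split.
  apply: (@mpolyX_dvd_mulX _ _ 0 1 _ ('X_1 * horner_alg z p * k - d 'X_1)) => //.
  rewrite mulrBr; apply/eqP; rewrite eq_sym subr_eq; apply/eqP.
  rewrite [X in _ = X + _]mulrC eq_k /z; ring.
apply: (@mpolyX_dvd_mulX _ _ 1 0 _ ('X_0 * horner_alg z p * k - d 'X_0)) => //.
rewrite mulrBr; apply/eqP; rewrite eq_sym subr_eq; apply/eqP.
rewrite [X in _ = _ + X]mulrC addrC eq_k /z; ring.
Qed.

(* If h were 0, every derivation would be logarithmic and kill xy. *)
Lemma mulXX_horner_alg_neq0 : h != 0.
Proof.
apply/eqP => h_eq0.
have der_x : is_derivation (vect_field 1 0 : A -> A) by apply: vect_field_derivation.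
have [|k] := @log_der_mulXX_dvd (vect_field 1 0).
  by split=> //; exists 0; rewrite h_eq0 /vect_field !mderiv0 !mulr0 addr0.
rewrite h_eq0 mul0r /z der_x.2 vect_fieldX0 vect_fieldX1 mulr0 mul1r addr0.
by apply/eqP/mpolyX_neq0.
Qed.

End LogarithmicDerivations.

Lemma contractE (C : fieldType) d (w : ratform C) :
  contract d w = w 0 0 * (d 'X_0)%:F + w 0 1 * (d 'X_1)%:F.
Proof.
rewrite /contract big_ord_recl big_ord1.
by have -> : lift ord0 ord0 = 1 :> 'I_2 by apply: val_inj.
Qed.

Lemma ratformE (C : fieldType) (a b : ratfun C) :
  (a *: dx + b *: dy) 0 0 = a /\ (a *: dx + b *: dy) 0 1 = b.
Proof.
by rewrite !mxE /= !mulr1 !mulr0 addr0 add0r.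
Qed.

Theorem lemma4p1 (R : realType) (n : nat) (alpha : nat -> R[i])
  (hn : (0 < n)%N) (halpha : alpha 1%N * alpha n != 0) :
  let x : {mpoly R[i][2]} := 'X_0 in
  let y : {mpoly R[i][2]} := 'X_1 in
  let ht : {poly R[i]} := \sum_(1 <= i < n.+1) alpha i *: 'X^(i.-1) in
  coprimep ht ht^`() ->
  let hxy : {mpoly R[i][2]} := horner_alg (x * y) ht in
  let h : {mpoly R[i][2]} := x * y * hxy in
  let E2 := vect_field x y in
  let Rvf := vect_field (- x) y in
  let delta1 := fun f => hxy * E2 f in
  let delta2 := Rvf in
  let omega1 := (y%:F / (2 * h)%:F) *: dx + (x%:F / (2 * h)%:F) *: dy in
  let omega2 := (1 / (2 * y)%:F) *: dy - (1 / (2 * x)%:F) *: dx in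
  let B := [tuple delta1; delta2] in
  let Bdual := [tuple omega1; omega2] in
  saito_basis_der h B /\ saito_basis_form h Bdual /\ dual_bases B Bdual.
Proof.
move=> x y ht cop hxy h E2 Rvf delta1 delta2 omega1 omega2 B Bdual.
(* The value at 0 is [alpha 1]: after the first term only positive powers of ['X] remain. *)
have ht0 : ht.[0] != 0.
  rewrite /ht big_nat_recl //= hornerD hornerZ hornerXn expr0 mulr1.
  rewrite horner_sum big_nat big1 ?addr0 => [|i /andP[i_gt0 _]].
    by apply: contraNneq halpha => ->; rewrite mul0r.
  by rewrite hornerZ hornerXn -(prednK i_gt0) /= expr0n /= mulr0.
have x0 : x%:F != 0 by rewrite tofrac_eq0 mpolyX_neq0.
have y0 : y%:F != 0 by rewrite tofrac_eq0 mpolyX_neq0.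
have h0 : h != 0 by apply: mulXX_horner_alg_neq0.
have hF0 : h%:F != 0 by rewrite tofrac_eq0.
have two0 : 2 != 0 :> ratfun R[i].
  rewrite -(rmorph_nat (@FracField.tofrac _)) tofrac_eq0.
  by rewrite -(rmorph_nat (@mpolyC 2 R[i])) mpolyC_eq0 Num.Theory.pnatr_eq0.
(* The factor 1/2 of both forms is needed as a polynomial, for the polynomial values of the forms
   and as the unit in their wedge product. *)
pose half : {mpoly R[i][2]} := (2^-1)%:MP.
have half2 : half * 2 = 1.
  rewrite -(rmorph_nat (@mpolyC 2 R[i])) -rmorphM mulVf ?rmorph1 //.
  by rewrite Num.Theory.pnatr_eq0.
have halfF : half%:F = 2^-1.
  apply: (mulIf two0); rewrite mulVf // -(rmorph_nat (@FracField.tofrac _)).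
  by rewrite -rmorphM half2 rmorph1.
have hF : h%:F = x%:F * y%:F * hxy%:F by rewrite /h !rmorphM.
have twoF (f : {mpoly R[i][2]}) : (2 * f)%:F = 2 * f%:F.
  by rewrite rmorphM /= rmorph_nat.
have [w10 w11] : omega1 0 0 = y%:F / (2 * h%:F) /\ omega1 0 1 = x%:F / (2 * h%:F).
  by rewrite /omega1 twoF; apply: ratformE.
have [w20 w21] : omega2 0 0 = - (2 * x%:F)^-1 /\ omega2 0 1 = (2 * y%:F)^-1.
  by rewrite /omega2 !twoF !div1r addrC -scaleNr; apply: ratformE.
have E2x : E2 x = x by apply: vect_fieldX0.
have E2y : E2 y = y by apply: vect_fieldX1.
have Rx : Rvf x = - x by apply: vect_fieldX0.
have Ry : Rvf y = y by apply: vect_fieldX1.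
(* The product xy has degree 2 for the Euler field and weight -1 + 1 = 0 for [Rvf]; the chain rule
   carries both facts over to [hxy]. *)
have E2z : E2 (x * y) = 2 * (x * y).
  by rewrite /E2 (vect_field_derivation x y).2 -/E2 E2x E2y; ring.
have Rz : Rvf (x * y) = 0.
  by rewrite /Rvf (vect_field_derivation (- x) y).2 -/Rvf Rx Ry; ring.
have E2h : E2 hxy = horner_alg (x * y) ht^`() * (2 * (x * y)).
  by rewrite -E2z; apply: derivation_horner_alg (vect_field_derivation x y).
have Rh : Rvf hxy = 0.
  rewrite -(mulr0 (horner_alg (x * y) ht^`())) -Rz.
  exact: derivation_horner_alg (vect_field_derivation (- x) y).
have log1 : log_der h delta1.
  split; first exact: mul_derivation (vect_field_derivation x y).
  exists (2 * hxy + 2 * (x * y) * horner_alg (x * y) ht^`()).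
  rewrite /delta1 /h /E2 (vect_field_derivation x y).2 -/E2 E2z E2h.
  by move: (horner_alg _ ht^`()) => a; clearbody hxy; move: (x * y) => b; ring.
have log2 : log_der h delta2.
  split; first exact: vect_field_derivation.
  exists 0; rewrite /delta2 /h /Rvf (vect_field_derivation (- x) y).2 -/Rvf Rz Rh; ring.
split; last split.
- split; first by case=> [[|[|//]] lti]; rewrite (tnth_nth delta1).
  (* The rows are [hxy] (x, y) and (-x, y), with determinant 2xy [hxy]. *)
  exists 2; rewrite det_mx22 !mxE !(tnth_nth delta1) /= /delta1 /delta2.
  rewrite -/x -/y E2x E2y Rx Ry /h.
  by clearbody hxy; ring.
- split.
    move=> j d log_d; have [[r dr] [s ds]] := log_der_X_dvd ht0 cop log_d.
    have [k dz] := log_der_mulXX_dvd ht0 cop log_d.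
    case: j => [[|[|//]] ltj]; rewrite (tnth_nth omega1) /= contractE.
      (* Here d(xy) = [h * k], so d(xy) / 2h is [k] / 2. *)
      exists (half * k); rewrite w10 w11.
      have dzF : (d x)%:F * y%:F + x%:F * (d y)%:F = h%:F * k%:F.
        by rewrite -!rmorphM -rmorphD -dz (log_d.1).2.
      by rewrite -/x -/y (tofracM half) halfF (pairing_omega1 two0 hF0 dzF).
    exists (half * (s - r)); rewrite w20 w21 dr ds -/x -/y !tofracM tofracB halfF.
    exact: pairing_omega2 two0 x0 y0 _ _.
  exists half; first by apply: rmorph_unit; rewrite unitfE invr_eq0 Num.Theory.pnatr_eq0.
  rewrite /wedge !(tnth_nth omega1) /= w10 w11 w20 w21 halfF.
  exact: (wedge_omega12 two0 x0 y0 hF0).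
- case=> [[|[|//]] lti] [[|[|//]] ltj];
    rewrite (tnth_nth delta1) (tnth_nth omega1) /= contractE -/x -/y.
  (* The constant 2 comes from [delta1] (xy) = 2h; for [delta2] it becomes 0, since [delta2] kills
     xy. *)
  + rewrite /delta1 w10 w11 E2x E2y (@pairing_omega1 _ _ _ _ two0 hF0 _ _ 2) ?mulVf //.
    by rewrite hF !tofracM; ring.
  + rewrite /delta1 w20 w21 E2x E2y !tofracM.
    by rewrite ![hxy%:F * _]mulrC (pairing_omega2 two0 x0 y0) subrr mulr0.
  + rewrite /delta2 w10 w11 Rx Ry (@pairing_omega1 _ _ _ _ two0 hF0 _ _ 0) ?mulr0 //.
    by rewrite tofracN; ring.
  + rewrite /delta2 w20 w21 Rx Ry tofracN.
    (* The field [delta2] has logarithmic derivatives -1 on x and 1 on y, whose half difference is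
       1. *)
    have := pairing_omega2 two0 x0 y0 (-1) 1.
    by rewrite mulrN1 mulr1 opprK => ->; exact: mulVf two0.
Qed.
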